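(* For $0<\mu<L$ and $\epsilon>0$ let $$K_\epsilon=\Big\{z\in\mathbb{C}:\Big(\frac{\operatorname{Re}z-\frac{\mu+L}{2}}{\frac{L-\mu}{2}}\Big)^2+\Big(\frac{\operatorname{Im}z}{\epsilon}\Big)^2\le1\Big\}.$$ Define $\epsilon=\epsilon(\mu,L)$ by $\frac{\epsilon(\mu,L)}{L}=\left(\frac{\mu}{L}\right)^{\theta}$ with $\theta>0$. Then, when $\frac{\mu}{L}\to0$, $$\underline{\rho}(K_\epsilon)=\begin{cases}1-2\sqrt{\frac{\mu}{L}}+O\big((\frac{\mu}{L})^{\min(\theta,1)}\big)&\text{if }\theta>\frac12,\\[2pt]1-2(\sqrt2-1)\sqrt{\frac{\mu}{L}}+O\big(\frac{\mu}{L}\big)&\text{if }\theta=\frac12,\\[2pt]1-(\frac{\mu}{L})^{1-\theta}+O\big((\frac{\mu}{L})^{\min(1,\,2-3\theta)}\big)&\text{if }\theta<\frac12.\end{cases}$$ Moreover, the momentum method is optimal for $K_\epsilon$. This means that there exist $\alpha>0$ and $\beta>0$ (functions of $\mu$, $L$ and $\epsilon$ only) such that, if all eigenvalues of $\mathbf{J}_F(\omega^* )$ lie in $K_\epsilon$, then $$\rho\big(\mathbf{J}_{V^{\mathrm{Polyak}}}(\omega^*,\omega^* )\big)\le\underline{\rho}(K_\epsilon).$$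
   Context: $F:\mathbb{R}^d\to\mathbb{R}^d$ is a differentiable vector field, $\omega^*$ is a point with $F(\omega^* )=0$, and $\mathbf{J}_F(\omega^* )$ is the Jacobian of $F$ at $\omega^*$. The momentum (Polyak heavy-ball) method with parameters $\alpha,\beta$ is $\omega_{t+1}=V^{\mathrm{Polyak}}(\omega_t,\omega_{t-1})=\omega_t-\alpha F(\omega_t)+\beta(\omega_t-\omega_{t-1})$. For a square matrix $M$, $\rho(M)$ denotes its spectral radius; $\rho(\mathbf{J}_{V^{\mathrm{Polyak}}}(\omega^*,\omega^* ))$ means the spectral radius of the Jacobian at $(\omega^*,\omega^* )$ of the augmented map $(\omega_t,\omega_{t-1})\mapsto(\omega_{t+1},\omega_t)$, that is, of the matrix $$\begin{pmatrix}(1+\beta)I_d-\alpha\mathbf{J}_F(\omega^* )&-\beta I_d\\ I_d&0\end{pmatrix}.$$ For an integer $t\ge1$, $\mathcal{P}_t$ is the set of real polynomials $p$ of degree at most $t$ with $p(0)=1$. For a set $K\subset\mathbb{C}$ symmetric with respect to the real axis, the asymptotic convergence factor is $$\underline{\rho}(K)=\inf_{t\ge1}\ \min_{p_t\in\mathcal{P}_t}\ \max_{\lambda\in K}|p_t(\lambda)|^{1/t}.$$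
   Formalization: Positivity of β is claimed only when ε < (L−μ)/2, as holds for small μ/L; for ε ≥ (L−μ)/2 it is false (e.g. μ=1, L=3, ε=1 forces β ≤ 0), and there only α > 0, a real β and the optimality bound are asserted. *)

(* Defs.v *)
From mathcomp Require Export all_boot all_order all_algebra.
From mathcomp Require Export all_classical all_reals all_analysis.
From mathcomp Require Export complex.
Export Order.TTheory GRing.Theory Num.Theory.
Export numFieldNormedType.Exports.

Set Implicit Arguments.
Unset Strict Implicit.
Unset Printing Implicit Defensive.

Local Open Scope classical_set_scope.
Local Open Scope ring_scope.
Local Open Scope complex_scope.

Definition modulus (R : realType) (z : R[i]) : R := ComplexField.Normc.normc z.

(* For d = 0 the set is empty and the supremum is 0. *)
Definition spectral_radius (R : realType) (d : nat) (M : 'M[R]_d) : R :=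
  sup [set modulus z | z in
         [set z : R[i] | eigenvalue (map_mx (real_complex R) M) z]].

Definition horner_complex (R : realType) (p : {poly R}) (z : R[i]) : R[i] :=
  (map_poly (real_complex R) p).[z].

Definition normalized_poly (R : realType) (t : nat) : set {poly R} :=
  [set p : {poly R} | (size p <= t.+1)%N /\ p.[0] = 1].

(* The maximum over K is written with the real-valued [sup] (0 on unbounded
   sets), so this definition is meaningful only for K nonempty and bounded. *)
Definition asymptotic_convergence_factor (R : realType) (K : set R[i]) : R :=
  inf [set inf [set sup [set modulus (horner_complex p z) `^ (t%:R^-1) | z in K]
               | p in @normalized_poly R t]
      | t in [set t : nat | (1 <= t)%N]].

Definition ellipse (R : realType) (mu L eps : R) : set R[i] :=
  [set z | ((complex.Re z - (mu + L) / 2) / ((L - mu) / 2)) ^+ 2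
           + (complex.Im z / eps) ^+ 2 <= 1].

(* f (mu, L) = O(g (mu / L)) as mu / L -> 0, over all pairs 0 < mu < L: the
   constants do not depend on mu and L separately. *)
Definition bigO_ratio (R : realType) (f : R -> R -> R) (g : R -> R) : Prop :=
  exists C delta : R, 0 < delta /\
    forall mu L : R, 0 < mu -> mu < L -> mu / L < delta ->
      `|f mu L| <= C * `|g (mu / L)|.

(* Augmented map (omega_t, omega_(t-1)) |-> (omega_(t+1), omega_t), the pair being
   a concatenated row vector. [jacobian] acts on row vectors by right
   multiplication: it is the transpose of the column-vector Jacobian, with the
   same eigenvalues. *)
Definition polyak (R : realType) (d : nat) (alpha beta : R)
    (F : 'rV[R]_d -> 'rV[R]_d) (u : 'rV[R]_(d + d)) : 'rV[R]_(d + d) :=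
  let x := lsubmx u in
  let y := rsubmx u in
  row_mx (x - alpha *: F x + beta *: (x - y)) x.

(* Main.v *)
Require Import Defs.
From mathcomp Require Import separable cyclic cyclotomic ring lra zify.
Local Open Scope classical_set_scope.
Local Open Scope ring_scope.

Set Implicit Arguments.
Unset Strict Implicit.
Unset Printing Implicit Defensive.

(* Let the ellipse have center c and semi-axes a along the real axis, b along
   the imaginary one, and put D = c + sqrt (c^2 - a^2 + b^2).  With al = 2 / D,
   k = (a^2 - b^2) / D^2 and r = (a + b) / D, the map
   w |-> (1 + k - w - k / w) / al sends the circle |w| = r onto the boundary of
   the ellipse, the exterior of this circle to the exterior of the ellipse, and
   1 to 0.  The eigenvalues of the momentum method with step al and momentum k
   are the preimages w of the eigenvalues of the Jacobian, so they satisfy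
   |w| <= r.

   The convergence factor is r.  If p has degree at most t and p(0) = 1, then
   u^t p((1 + k - 1/u - k u) / al) is a polynomial in u equal to 1 at u = 1, and
   the maximum principle on |u| <= 1/r gives max_K |p| >= r^t.  Conversely the
   Dickson (rescaled Chebyshev) polynomials, for which D_t(w + k / w) =
   w^t + (k / w)^t, are at most 2 r^t on the ellipse and about 1 at the origin.

   In terms of x = mu / L and e = eps / L this reads
   r = (1 - x + 2 e) / (1 + x + 2 sqrt (x + e^2)), which is then expanded. *)

(** * Maximum modulus principle for polynomials *)

(** By Bernoulli, powers of a ratio above 1 outgrow any constant. This drops constant factors twice:
    in the maximum principle and in the upper bound on the convergence factor. *)
Lemma expn_le_cst_le (R : realType) (x y K : R) :
  0 <= x -> 0 <= y -> (forall n, (0 < n)%N -> x ^+ n <= K * y ^+ n) -> x <= y.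
Proof.
move=> x0 y0 H; rewrite leNgt; apply/negP => yx.
have [y_eq0|yN0] := eqVneq y 0.
  move: (H 1%N isT) yx; rewrite !expr1 y_eq0 mulr0 => xle /(le_lt_trans xle).
  by rewrite ltxx.
have {yN0}yp : 0 < y by rewrite lt_def yN0.
have bern n : 1 + (x / y - 1) *+ n <= (x / y) ^+ n.
  have d0 : 1 <= x / y by rewrite ler_pdivlMr // mul1r ltW.
  elim: n => [|n IH]; first by rewrite mulr0n addr0 expr0.
  rewrite exprS; apply: le_trans (_ : x / y * (1 + (x / y - 1) *+ n) <= _).
    rewrite mulrSr -[_ *+ n]mulr_natr.
    have : 0 <= n%:R :> R by [].
    move: (n%:R : R) (x / y) d0 => m q q1 m0.
    by have := mulr_ge0 (sqr_ge0 (q - 1)) m0; nra.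
  by rewrite ler_wpM2l // divr_ge0.
have d0 : 0 < x / y - 1 by rewrite subr_gt0 ltr_pdivlMr // mul1r.
pose n := (Num.truncn (K / (x / y - 1))).+1.
have : K < (x / y - 1) *+ n.
  by rewrite -mulr_natr mulrC -ltr_pdivrMr // truncnS_gt.
have : (x / y) ^+ n <= K by rewrite expr_div_n ler_pdivrMr ?exprn_gt0 // H.
move: (bern n); lra.
Qed.

Section MaximumModulus.
Variable C : numClosedFieldType.
Implicit Types (p : {poly C}) (s M v : C).

Lemma exists_primitive_root n : (0 < n)%N -> exists z : C, n.-primitive_root z.
Proof.
move=> n_gt0; have [r def_p] := closed_field_poly_normal ('X^n - 1 : {poly C}).
rewrite (monicP _) ?monicXnsubC // scale1r in def_p.
have rn1 : all n.-unity_root r.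
  by apply/allP => z; rewrite -root_prod_XsubC -def_p.
have sz_r : (n < (size r).+1)%N.
  by rewrite -(size_prod_XsubC r id) -def_p size_XnsubC.
have [|z] := hasP (has_prim_root n_gt0 rn1 _ sz_r); last by exists z.
by rewrite -separable_prod_XsubC -def_p separable_Xn_sub_1 // pnatr_eq0 -lt0n.
Qed.

Lemma sum_exp_primitive_root n z m :
  n.-primitive_root z -> \sum_(j < n) (z ^+ m) ^+ j = (n %| m)%N%:R * n%:R :> C.
Proof.
move=> prim_z; rewrite (prim_order_dvd prim_z).
have [->|zm1] := eqVneq (z ^+ m) 1.
  by under eq_bigr do rewrite expr1n; rewrite sumr_const card_ord mul1r.
rewrite mul0r; have/eqP := subrX1 (z ^+ m) n.
rewrite exprAC (prim_expr_order prim_z) expr1n subrr eq_sym mulf_eq0 subr_eq0.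
by rewrite (negPf zm1) => /eqP.
Qed.

(** Discrete Cauchy formula: averaging over the [n]-th roots of unity isolates one coefficient
    exactly. *)
Lemma cauchy_coef_bound p s M k : 0 < s ->
  (forall w, `|w| = s -> `|p.[w]| <= M) -> `|p`_k| * s ^+ k <= M.
Proof.
(* [n] exceeds [k] and every index of [p], so no other coefficient is aliased onto the [k]-th. *)
move=> s0 pM; pose n := (size p + k).+1.
have [z prim_z] := exists_primitive_root (ltn0Sn (size p + k)).
have normz : `|z| = 1.
  apply/eqP; rewrite -(pexpr_eq1 (ltn0Sn (size p + k))) // -normrX.
  by rewrite prim_expr_order // normr1.
have coefE : p`_k * s ^+ k * n%:R
           = \sum_(j < n) p.[s * z ^+ j] * (z ^+ (n - k)) ^+ j.
  under eq_bigr => j _.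
    rewrite (@horner_coef_wide _ n) ?leqW ?leq_addr // mulr_suml.
    under eq_bigr => i _ do
      rewrite exprMn [(z ^+ j) ^+ i]exprAC -!mulrA -exprMn -exprD mulrA.
    over.
  have k_n : (k < n)%N by rewrite ltnS leq_addl.
  rewrite exchange_big /= (bigD1 (Ordinal k_n)) //= [X in _ + X]big1 ?addr0.
    rewrite -mulr_sumr sum_exp_primitive_root // subnKC ?dvdnn ?mul1r //.
    exact: ltnW.
  (* Since [0 < n - k + i < 2 * n], divisibility by [n] would force [i = k]. *)
  move=> i ik; rewrite -mulr_sumr sum_exp_primitive_root //.
  case: dvdnP => [[q Hq]|]; last by rewrite mul0r mulr0.
  case/negP: ik; apply/eqP/val_inj => /=; move: (ltn_ord i) k_n Hq.
  case: q => [|[|q]]; nia.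
have n0 : 0 < n%:R :> C by rewrite ltr0n.
rewrite -(ler_pM2r n0) -[s ^+ k]gtr0_norm ?exprn_gt0 // -[X in _ * X <= _]gtr0_norm //.
rewrite -!normrM coefE; apply: le_trans (ler_norm_sum _ _ _) _.
have -> : M * n%:R = \sum_(j < n) M by rewrite sumr_const card_ord mulr_natr.
apply: ler_sum => j _.
rewrite normrM !normrX normz !expr1n mulr1 pM // normrM normrX normz expr1n mulr1.
by rewrite gtr0_norm.
Qed.

(** Bounding each coefficient by Cauchy leaves a geometric series in [|v| / s]. *)
Lemma horner_le_geometric p s M v : 0 < s -> `|v| < s ->
  (forall w, `|w| = s -> `|p.[w]| <= M) -> `|p.[v]| <= (1 - `|v| / s)^-1 * M.
Proof.
move=> s0 vs pM; have M0 : 0 <= M by rewrite (le_trans _ (pM s _)) // gtr0_norm.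
have q1 : 0 < 1 - `|v| / s by rewrite subr_gt0 ltr_pdivrMr // mul1r.
have q0 : 0 <= `|v| / s by rewrite divr_ge0 // ltW.
rewrite horner_coef; apply: le_trans (ler_norm_sum _ _ _) _.
apply: le_trans (_ : \sum_(i < size p) (`|v| / s) ^+ i * M <= _).
  apply: ler_sum => i _; rewrite normrM normrX expr_div_n.
  rewrite mulrAC ler_pdivlMr ?exprn_gt0 // mulrAC [leRHS]mulrC.
  by rewrite ler_wpM2r ?exprn_ge0 // cauchy_coef_bound.
rewrite -mulr_suml ler_wpM2r // -[leRHS]mulr1 ler_pdivlMl //.
have := subrX1 (`|v| / s) (size p); rewrite -opprB -[X in _ = X * _]opprB mulNr.
by move/oppr_inj <-; rewrite gerBl exprn_ge0.
Qed.

End MaximumModulus.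

Lemma modulus_norm (R : realType) (z : R[i]) : `|z| = (modulus z)%:C%C.
Proof. by []. Qed.

Lemma modulus_ge0 (R : realType) (z : R[i]) : 0 <= modulus z.
Proof. by rewrite -ler0c -modulus_norm. Qed.

(* Applying the geometric bound to the powers of [p] removes its constant. *)
Lemma maximum_modulus_poly (R : realType) (p : {poly R[i]}) (s M : R) (v : R[i]) :
  modulus v < s -> (forall w, modulus w = s -> modulus p.[w] <= M) ->
  modulus p.[v] <= M.
Proof.
move=> vs pM; have s0 : 0 < s by apply: le_lt_trans vs; exact: modulus_ge0.
have M0 : 0 <= M.
  apply: le_trans (modulus_ge0 _) (pM s%:C%C _).
  by apply: complexI; rewrite -modulus_norm ger0_norm // ler0c ltW.
apply: (@expn_le_cst_le _ _ _ (1 - modulus v / s)^-1) => //.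
  exact: modulus_ge0.
move=> n _; rewrite -lecR !(rmorphM, rmorphXn, fmorphV, rmorphB, rmorph1) /=.
rewrite -!modulus_norm -normrX -horner_exp.
apply: horner_le_geometric; rewrite ?ltr0c ?modulus_norm ?ltcR // => w.
rewrite modulus_norm => /complexI ws.
rewrite horner_exp normrX lerXn2r ?nnegrE ?normr_ge0 ?ler0c //.
by rewrite modulus_norm lecR pM.
Qed.

(** * The Joukowski map and the ellipse *)

Lemma modulusE (R : realType) (x y : R) :
  modulus (x +i* y)%C = Num.sqrt (x ^+ 2 + y ^+ 2).
Proof. by []. Qed.

Definition ellipse_at (R : realType) (c a b : R) : set R[i] :=
  [set z | ((complex.Re z - c) / a) ^+ 2 + (complex.Im z / b) ^+ 2 <= 1].

(* The map [w |-> (1 + k - w - k / w) / al] sends the circle of radius [r] to the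
   boundary of the ellipse of center [c] and semi-axes [a], [b]. *)
Record joukowski (R : realType) (c a b r k al : R) : Prop := Joukowski {
  jk_a : 0 < a; jk_b : 0 < b; jk_r0 : 0 < r; jk_r1 : r < 1; jk_al : 0 < al;
  jk_c : al * c = 1 + k;
  jk_ar : al * a = r + k / r;
  jk_br : al * b = r - k / r }.

Section Joukowski.
Variables (R : realType) (c a b r k al : R).
Hypothesis jk : joukowski c a b r k al.

(** Multiplied by [al * r], the positive semi-axes become [r ^+ 2 + k] and [r ^+ 2 - k]. *)
Lemma joukowski_momentum_lt : `|k| < r ^+ 2.
Proof.
have [a0 b0 r0 r1 al0 jc jar jbr] := jk.
have := mulr_gt0 (mulr_gt0 al0 a0) r0; have := mulr_gt0 (mulr_gt0 al0 b0) r0.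
rewrite jar jbr mulrBl mulrDl divfK ?gt_eqF // -expr2 => *.
by rewrite ltr_norml; apply/andP; split; lra.
Qed.

(** If [|z| > r], the point [z + k / z = 1 + k - al * l] lies on an ellipse of semi-axes
    [|z| + k / |z|] and [|z| - k / |z|], strictly outside the one of semi-axes [al * a] and
    [al * b]. *)
Lemma joukowski_root_le (l z : R[i]) : ellipse_at c a b l ->
  z ^+ 2 - (1 + k%:C%C - al%:C%C * l) * z + k%:C%C = 0 -> modulus z <= r.
Proof.
have [a0 b0 r0 r1 al0 jc jar jbr] := jk.
have kr := joukowski_momentum_lt.
case: l z => [u v] [x y]; rewrite modulusE /ellipse_at /= expr2 => El /eqP.
rewrite eq_complex /=; simpc => /andP[/eqP eq1 /eqP eq2].
rewrite -[leRHS]gtr0_norm // -sqrtr_sqr; apply: ler_wsqrtr; rewrite leNgt.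
apply/negP; set S := x ^+ 2 + y ^+ 2 => rS.
set A := al * a in jar; set B := al * b in jbr.
have A0 : 0 < A by rewrite mulr_gt0.
have B0 : 0 < B by rewrite mulr_gt0.
have S0 : 0 < S by apply: lt_trans rS; rewrite exprn_gt0.
set X := 1 + k - al * u in eq1 eq2; set Y := - (al * v).
(* [XS] and [YS] are the real and imaginary parts of the equation multiplied by the conjugate of
   [z]. *)
have XS : X * S = x * (S + k).
  by have /= := congr1 ( *%R x) eq1; have /= := congr1 ( *%R y) eq2; rewrite /S /X; lra.
have YS : Y * S = y * (S - k).
  have /= := congr1 ( *%R y) eq1; have /= := congr1 ( *%R x) eq2.
  by rewrite /S /X /Y; lra.
(* For [e = k] and [e = - k], this compares the squared semi-axes, scaled by [S], of the ellipses
   attached to [|z|] and to [r]. *)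
have gap (e : R) : e ^+ 2 = k ^+ 2 -> 0 < (S + e) ^+ 2 - S * (r + e / r) ^+ 2.
  move=> ek; have -> : (S + e) ^+ 2 - S * (r + e / r) ^+ 2
      = (S - r ^+ 2) * (r ^+ 2 * S - k ^+ 2) / r ^+ 2.
    by rewrite -ek; field; rewrite gt_eqF.
  rewrite divr_gt0 ?exprn_gt0 // mulr_gt0 ?subr_gt0 //.
  apply: lt_le_trans (_ : r ^+ 2 * r ^+ 2 <= _).
    by rewrite -[k ^+ 2]real_normK ?num_real // -expr2 ltrXn2r // nnegrE // ltW ?exprn_gt0.
  by rewrite ler_pM2l ?exprn_gt0 // ltW.
have := gap k erefl; rewrite -jar => P0.
have := gap (- k) (sqrrN k); rewrite mulNr -jbr => Q0.
set P := (S + k) ^+ 2 - _ in P0; set Q := (S - k) ^+ 2 - _ in Q0.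
have : X ^+ 2 * B ^+ 2 + Y ^+ 2 * A ^+ 2 <= A ^+ 2 * B ^+ 2.
  have -> : X ^+ 2 * B ^+ 2 + Y ^+ 2 * A ^+ 2
      = ((u - c) / a * ((u - c) / a) + (v / b) ^+ 2) * (A ^+ 2 * B ^+ 2).
    have -> : X = - (al * (u - c)) by rewrite mulrBr jc /X; ring.
    by rewrite /A /B /Y; field; rewrite !gt_eqF.
  by rewrite ler_piMl // mulr_ge0 // exprn_ge0 // ltW.
rewrite -(ler_pM2r (exprn_gt0 2 S0)).
have -> : (X ^+ 2 * B ^+ 2 + Y ^+ 2 * A ^+ 2) * S ^+ 2
    = (X * S) ^+ 2 * B ^+ 2 + (Y * S) ^+ 2 * A ^+ 2 by ring.
rewrite XS YS [(x * _) ^+ 2]exprMn [(y * _) ^+ 2]exprMn.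
have -> : (S + k) ^+ 2 = P + S * A ^+ 2 by rewrite subrK.
have -> : (S - k) ^+ 2 = Q + S * B ^+ 2 by rewrite subrK.
have -> : x ^+ 2 * (P + S * A ^+ 2) * B ^+ 2 + y ^+ 2 * (Q + S * B ^+ 2) * A ^+ 2
  = x ^+ 2 * (P * B ^+ 2) + y ^+ 2 * (Q * A ^+ 2) + A ^+ 2 * B ^+ 2 * S ^+ 2.
  by rewrite /S; ring.
rewrite gerDr => xy0.
have PB : 0 < P * B ^+ 2 by rewrite mulr_gt0 // exprn_gt0.
have QA : 0 < Q * A ^+ 2 by rewrite mulr_gt0 // exprn_gt0.
(* Replacing both weights by the smaller one leaves a positive multiple of [x ^+ 2 + y ^+ 2 = S]. *)
have [le|/ltW le] := leP (P * B ^+ 2) (Q * A ^+ 2).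
  by have := mulr_gt0 PB S0; have := ler_wpM2l (sqr_ge0 y) le; rewrite /S; lra.
by have := mulr_gt0 QA S0; have := ler_wpM2l (sqr_ge0 x) le; rewrite /S; lra.
Qed.

(** On the circle, [1 / w] is the conjugate of [w] over [r ^+ 2], so [x + iy] is sent to the point
    of coordinates [c - a * x / r] and [- b * y / r]. *)
Lemma joukowski_boundary (w : R[i]) : modulus w = r ->
  ellipse_at c a b ((1 + k%:C%C - w - k%:C%C / w) / al%:C%C).
Proof.
have [a0 b0 r0 r1 al0 jc jar jbr] := jk.
case: w => [x y]; rewrite modulusE => xyr.
have S : x ^+ 2 + y ^+ 2 = r ^+ 2 by rewrite -xyr sqr_sqrtr // addr_ge0 ?sqr_ge0.
rewrite /ellipse_at /= S; simpc.
have -> : 1 + k - x - k * (x / r ^+ 2) = al * c - x * (al * a) / r.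
  by rewrite jc jar; field; rewrite gt_eqF.
have -> : - y + k * (y / r ^+ 2) = - (y * (al * b) / r).
  by rewrite jbr; field; rewrite gt_eqF.
rewrite expr0n addr0.
have -> : ((al * c - x * (al * a) / r) * (al / al ^+ 2) - c) / a = - (x / r).
  by field; rewrite !gt_eqF.
have -> : - (y * (al * b) / r) * (al / al ^+ 2) / b = - (y / r).
  by field; rewrite !gt_eqF.
by rewrite !sqrrN !expr_div_n -mulrDl S divff // expf_neq0 // gt_eqF.
Qed.
End Joukowski.

(** * Complex moduli and boundedness on the ellipse *)

Lemma modulusM (R : realType) (x y : R[i]) : modulus (x * y) = modulus x * modulus y.
Proof. by apply: complexI; rewrite rmorphM /= -!modulus_norm normrM. Qed.

Lemma modulusX (R : realType) (x : R[i]) n : modulus (x ^+ n) = modulus x ^+ n.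
Proof. by apply: complexI; rewrite rmorphXn /= -!modulus_norm normrX. Qed.

Lemma modulusV (R : realType) (x : R[i]) : modulus x^-1 = (modulus x)^-1.
Proof. by apply: complexI; rewrite fmorphV /= -!modulus_norm normfV. Qed.

Lemma modulusD (R : realType) (x y : R[i]) : modulus (x + y) <= modulus x + modulus y.
Proof. by rewrite -lecR rmorphD /= -!modulus_norm ler_normD. Qed.

Lemma modulus_real (R : realType) (x : R) : modulus x%:C%C = `|x|.
Proof. by rewrite modulusE expr0n addr0 sqrtr_sqr. Qed.

Lemma horner_complex_real (R : realType) (p : {poly R}) (x : R) :
  horner_complex p x%:C%C = (p.[x])%:C%C.
Proof. by rewrite /horner_complex horner_map. Qed.

(** Together with a bound on the ellipse, this shows that the sets whose [sup] is taken are bounded;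
    otherwise [sup] would default to 0. *)
Lemma modulus_horner_le (R : realType) (p : {poly R}) (z : R[i]) (B : R) :
  modulus z <= B -> modulus (horner_complex p z) <= \sum_(i < size p) `|p`_i| * B ^+ i.
Proof.
move=> zB; rewrite /horner_complex (@horner_coef_wide _ (size p)) ?size_map_poly //.
rewrite -lecR -modulus_norm; apply: le_trans (ler_norm_sum _ _ _) _.
rewrite (rmorph_sum (real_complex R)) /=; apply: ler_sum => i _.
rewrite coef_map /= normrM normrX !modulus_norm modulus_real.
rewrite -rmorphXn /= -rmorphM /= lecR.
by rewrite ler_wpM2l // lerXn2r // ?nnegrE ?modulus_ge0 // (le_trans (modulus_ge0 _) zB).
Qed.

Lemma powR_invK (R : realType) (x : R) (t : nat) :
  0 <= x -> (0 < t)%N -> (x `^ t%:R^-1) ^+ t = x.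
Proof.
move=> x0 t0; rewrite -powR_mulrn ?powR_ge0 // -powRrM.
by rewrite mulVf ?powRr1 // pnatr_eq0 -lt0n.
Qed.

Lemma modulus_ellipse_le (R : realType) (c a b : R) (z : R[i]) :
  0 < a -> 0 < b -> ellipse_at c a b z -> modulus z <= `|c| + a + b.
Proof.
move=> a0 b0; case: z => x y; rewrite /ellipse_at modulusE /= => H.
have sq1 (u : R) : u ^+ 2 <= 1 -> `|u| <= 1.
  by rewrite -[u ^+ 2]real_normK ?num_real // expr_le1.
have : `|(x - c) / a| <= 1 by apply: sq1; have := sqr_ge0 (y / b); lra.
have : `|y / b| <= 1 by apply: sq1; have := sqr_ge0 ((x - c) / a); lra.
rewrite !normrM !normfV !(gtr0_norm a0, gtr0_norm b0) !ler_pdivrMr // !mul1r => yb xa.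
have cx : `|x| <= `|c| + a.
  by rewrite -[x](subrK c) addrC; apply: le_trans (ler_normD _ _) _; rewrite lerD2l.
apply: le_trans (_ : Num.sqrt ((`|x| + `|y|) ^+ 2) <= _).
  apply: ler_wsqrtr; rewrite sqrrD !real_normK ?num_real //.
  have := mulr_ge0 (normr_ge0 x) (normr_ge0 y); lra.
by rewrite sqrtr_sqr ger0_norm ?addr_ge0 // lerD.
Qed.

(** * Dickson polynomials *)

(** Dickson polynomials of the first kind. Unlike Chebyshev polynomials rescaled by a square root of
    [k], they also cover zero or negative [k], that is, ellipses at least as tall as wide. *)
Fixpoint dickson (A : comNzRingType) (k : A) n : {poly A} :=
  if n is m.+1 then
    if m is l.+1 then 'X * dickson k m - k *: dickson k l else 'X
  else 2%:P.

Lemma dicksonSS (A : comNzRingType) (k : A) n :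
  dickson k n.+2 = 'X * dickson k n.+1 - k *: dickson k n.
Proof. by []. Qed.

Lemma dickson_ind (P : nat -> Prop) :
  P 0%N -> P 1%N -> (forall n, P n -> P n.+1 -> P n.+2) -> forall n, P n.
Proof.
move=> P0 P1 PS n; suff [] : P n /\ P n.+1 by [].
by elim: n => [//|n [Pn PSn]]; split => //; exact: PS.
Qed.

Lemma size_dickson (A : comNzRingType) (k : A) n : (size (dickson k n) <= n.+1)%N.
Proof.
elim/dickson_ind: n => [||n IH0 IH1]; first exact: size_polyC_leq1.
  by rewrite size_polyX.
rewrite dicksonSS; apply: leq_trans (size_polyD _ _) _.
rewrite size_polyN geq_max; apply/andP; split.
  by rewrite mulrC; apply: leq_trans (size_polyMleq _ _) _; rewrite size_polyX addn2.
by apply: leq_trans (size_scale_leq _ _) _; apply: leq_trans IH0 _; rewrite ltnS leqW.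
Qed.

(** [u] and [v] are the roots of [X^2 - (u + v) X + u v], so their powers obey the Dickson
    recurrence. *)
Lemma horner_dickson (A : comNzRingType) (u v : A) n :
  (dickson (u * v) n).[u + v] = u ^+ n + v ^+ n.
Proof.
elim/dickson_ind: n => [||n IH0 IH1]; first by rewrite hornerC !expr0.
  by rewrite hornerX !expr1.
by rewrite dicksonSS !hornerE IH0 IH1 !exprS; ring.
Qed.

Lemma map_dickson (A B : comNzRingType) (f : {rmorphism A -> B}) (k : A) n :
  map_poly f (dickson k n) = dickson (f k) n.
Proof.
elim/dickson_ind: n => [||n IH0 IH1]; first by rewrite /= map_polyC /= rmorph_nat.
  by rewrite map_polyX.
by rewrite !dicksonSS rmorphB rmorphM /= map_polyX map_polyZ IH0 IH1.
Qed.

(** * Convergence factor of an ellipse *)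

Section EllipseFactor.
Variables (R : realType) (c a b r k al : R).
Hypothesis jk : joukowski c a b r k al.
Let K := ellipse_at c a b.
Let root_sup (t : nat) (p : {poly R}) :=
  sup [set modulus (horner_complex p z) `^ (t%:R^-1) | z in K].

Lemma ellipse_center : K c%:C%C.
Proof. by rewrite /K /ellipse_at /= subrr !mul0r expr0n addr0 ler01. Qed.

Lemma root_values_nonempty (p : {poly R}) (t : nat) :
  [set modulus (horner_complex p z) `^ (t%:R^-1) | z in K] !=set0.
Proof. by eexists; exists c%:C%C; [exact: ellipse_center|]. Qed.

Lemma root_values_le_sup (p : {poly R}) (t : nat) (z : R[i]) : K z ->
  modulus (horner_complex p z) `^ (t%:R^-1)
    <= root_sup t p.
Proof.
move=> Kz; apply: ub_le_sup; last by exists z.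
have [a0 b0 _ _ _ _ _ _] := jk.
exists ((\sum_(i < size p) `|p`_i| * (`|c| + a + b) ^+ i) `^ t%:R^-1) => _ [w Kw <-].
have le := modulus_horner_le p (modulus_ellipse_le a0 b0 Kw).
rewrite ge0_ler_powR // ?nnegrE ?invr_ge0 ?ler0n ?modulus_ge0 //.
exact: le_trans (modulus_ge0 _) le.
Qed.

(** A Bernstein-Walsh inequality at the origin: with [u = 1 / w] the exterior of the ellipse becomes
    the disc of radius [1 / r], and the factor [u ^+ t] removes the pole at 0. *)
Lemma normalized_poly_sup_ge (p : {poly R}) (t : nat) :
  (0 < t)%N -> normalized_poly t p ->
  r <= root_sup t p.
Proof.
move=> t0 [sp p0]; rewrite /root_sup; set m := sup _.
have [a0 b0 r0 r1 al0 jc jar jbr] := jk.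
have m0 : 0 <= m.
  by apply: le_trans (root_values_le_sup p t ellipse_center); exact: powR_ge0.
(* [g] is [u] times the map in the variable [u = 1 / w], so that [Q] homogenises [p] in degree
   [t]. *)
pose g : {poly R[i]} := al%:C%C^-1 *: ((1 + k%:C%C) *: 'X - 1 - k%:C%C *: 'X^2).
pose Q := \sum_(i < t.+1) (p`_i)%:C%C *: ('X^(t - i) * g ^+ i).
have QE u : u != 0 ->
    Q.[u] = u ^+ t * horner_complex p ((1 + k%:C%C - u^-1 - k%:C%C / u^-1) / al%:C%C).
  move=> u0; rewrite /horner_complex.
  rewrite [in RHS](@horner_coef_wide _ t.+1) ?size_map_poly //.
  rewrite /Q horner_sum mulr_sumr; apply: eq_bigr => i _.
  rewrite coef_map !hornerE /=.
  have -> : u ^+ t = u ^+ (t - i) * u ^+ i by rewrite -exprD subnK // -ltnS.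
  set q := _ / al%:C%C.
  have -> : al%:C%C^-1 * ((1 + k%:C%C) * u - 1 - k%:C%C * u * u) = u * q.
    by rewrite /q; field; rewrite u0 (inj_eq (@complexI R) al 0) gt_eqF.
  by rewrite exprMn [LHS]mulrA; congr (_ * _); rewrite -mulrA mulrC.
have Q1 : Q.[1] = 1.
  rewrite QE ?oner_neq0 // invr1 divr1 expr1n mul1r.
  have -> : 1 + k%:C%C - 1 - k%:C%C = 0 :> R[i] by ring.
  by rewrite mul0r (horner_complex_real p 0) p0.
(* The right side bounds [Q] on the circle of radius [1 / r], which encloses the point 1 because
   [r < 1]. *)
suff : 1 <= m ^+ t / r ^+ t.
  by rewrite ler_pdivlMr ?exprn_gt0 // mul1r ler_pXn2r // nnegrE ltW.
have -> : 1 = modulus Q.[1] by rewrite Q1 (modulus_real 1) normr1.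
apply: (@maximum_modulus_poly _ _ r^-1).
  by rewrite (modulus_real 1) normr1 invf_gt1.
move=> u ur; have u0 : u != 0.
  apply/eqP => u0; move: ur; rewrite u0 (modulus_real 0) normr0 => /esym/eqP.
  by rewrite invr_eq0 gt_eqF.
rewrite QE // modulusM modulusX ur exprVn mulrC ler_pM2r ?invr_gt0 ?exprn_gt0 //.
rewrite -(powR_invK (modulus_ge0 _) t0) lerXn2r ?nnegrE ?powR_ge0 //.
apply: root_values_le_sup; apply: joukowski_boundary => //.
by rewrite modulusV ur invrK.
Qed.

(** The witness is the Dickson polynomial at [1 + k - al * l], divided by its value [1 + k ^+ t] at
    the origin. That value is at least [1 - |k|], which makes the constant independent of [t]. *)
Lemma normalized_poly_sup_le (t : nat) : (0 < t)%N -> exists2 p, normalized_poly t p &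
  root_sup t p <= (2 / (1 - `|k|) * r ^+ t) `^ (t%:R^-1).
Proof.
move=> t0; have [a0 b0 r0 r1 al0 jc jar jbr] := jk.
have k1 : `|k| < 1.
  by apply: lt_le_trans (joukowski_momentum_lt jk) _; rewrite expr_le1 // ltW.
have kt : 1 - `|k| <= 1 + k ^+ t.
  have : - k ^+ t <= `|k|.
    rewrite -normrN; apply: le_trans (ler_norm _) _; rewrite !normrN normrX.
    by rewrite -(prednK t0) exprS ler_piMr // exprn_ile1 // ltW.
  lra.
have k10 : 0 < 1 - `|k| by rewrite subr_gt0.
have kt0 : 0 < 1 + k ^+ t := lt_le_trans k10 kt.
pose q : {poly R} := (1 + k)%:P - al *: 'X.
exists ((1 + k ^+ t)^-1 *: (dickson k t \Po q)).
  split.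
    apply: leq_trans (size_scale_leq _ _) _.
    apply: leq_trans (size_comp_poly_leq _ _) _.
    have sq : (size q <= 2)%N.
      apply: leq_trans (size_polyD _ _) _; rewrite size_polyN geq_max.
      rewrite (leq_trans (size_polyC_leq1 _)) //=.
      by apply: leq_trans (size_scale_leq _ _) _; rewrite size_polyX.
    rewrite ltnS; apply: leq_trans (_ : (size (dickson k t)).-1 * 1 <= t)%N.
      by rewrite leq_mul // -subn1 leq_subLR.
    by rewrite muln1 -subn1 leq_subLR size_dickson.
  rewrite hornerZ horner_comp /q !hornerE subr0.
  have := horner_dickson 1 k t; rewrite mul1r expr1n => ->.
  by rewrite mulVf // gt_eqF.
apply: ge_sup; first exact: root_values_nonempty.
move=> _ [l Kl <-]; rewrite ge0_ler_powR ?nnegrE ?invr_ge0 ?ler0n ?modulus_ge0 //.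
  by rewrite mulr_ge0 ?divr_ge0 ?exprn_ge0 // ltW.
rewrite /horner_complex map_polyZ map_comp_poly map_dickson hornerZ horner_comp.
have -> : (map_poly (real_complex R) q).[l] = 1 + k%:C%C - al%:C%C * l.
  by rewrite /q rmorphB /= map_polyC map_polyZ map_polyX !hornerE /= rmorphD rmorph1.
set x := 1 + _ - _.
(* Solving the quadratic writes [x] as a sum of two numbers of product [k]; both have modulus at
   most [r]. *)
pose w := sqrtc (x ^+ 2 - 4 * k%:C%C).
have ww : w ^+ 2 = x ^+ 2 - 4 * k%:C%C by rewrite sqr_sqrtc.
pose z1 := (x + w) / 2; pose z2 := (x - w) / 2.
have z1z2 : z1 * z2 = k%:C%C.
  have -> : z1 * z2 = (x ^+ 2 - w ^+ 2) / 4 by rewrite /z1 /z2; field.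
  by rewrite ww; field.
have z1Dz2 : z1 + z2 = x by rewrite /z1 /z2; field.
have z1r : modulus z1 <= r.
  by apply: (joukowski_root_le jk Kl); rewrite -/x -z1Dz2 -z1z2; ring.
have z2r : modulus z2 <= r.
  by apply: (joukowski_root_le jk Kl); rewrite -/x -z1Dz2 -z1z2; ring.
have -> : dickson (real_complex R k) t = dickson (z1 * z2) t by rewrite z1z2.
rewrite -z1Dz2 horner_dickson modulusM modulus_real.
rewrite gtr0_norm ?invr_gt0 // mulrC ler_pdivrMr //.
apply: le_trans (_ : 2 * r ^+ t <= _).
  apply: le_trans (modulusD _ _) _; rewrite !modulusX mulr_natl mulr2n.
  by rewrite lerD // lerXn2r ?nnegrE ?modulus_ge0 // ltW.
have -> : 2 * r ^+ t = 2 / (1 - `|k|) * r ^+ t * (1 - `|k|).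
  by field; rewrite gt_eqF.
by rewrite ler_wpM2l // mulr_ge0 ?divr_ge0 ?exprn_ge0 // ltW.
Qed.

(** The lower bound passes to both infima. For the upper one, the factor to the power [t] is at most
    a constant times [r ^+ t] for every [t], and comparing powers removes the constant without a
    limit. *)
Lemma asymptotic_convergence_factor_ellipse : asymptotic_convergence_factor K = r.
Proof.
have [a0 b0 r0 r1 al0 jc jar jbr] := jk.
have inner_ge (t : nat) : (0 < t)%N ->
    r <= inf [set root_sup t p | p in @normalized_poly R t].
  move=> t0; apply: lb_le_inf.
    by have [p pn _] := normalized_poly_sup_le t0; eexists; exists p.
  by move=> _ [p pn <-]; exact: normalized_poly_sup_ge.
have rI : r <= asymptotic_convergence_factor K.
  apply: lb_le_inf; first by eexists; exists 1%N.
  by move=> _ [t t0 <-]; exact: inner_ge.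
have r_ge0 := ltW r0; have I0 := le_trans r_ge0 rI.
have k1 : `|k| < 1.
  by apply: lt_le_trans (joukowski_momentum_lt jk) _; rewrite expr_le1 // ltW.
apply/eqP; rewrite eq_le rI andbT.
apply: (@expn_le_cst_le _ _ _ (2 / (1 - `|k|))) => // t t0.
rewrite -[leRHS](@powR_invK _ _ t) //; last first.
  by rewrite mulr_ge0 ?divr_ge0 ?exprn_ge0 // subr_ge0 ltW.
rewrite lerXn2r ?nnegrE ?powR_ge0 //.
have [p pn] := normalized_poly_sup_le t0; apply: le_trans.
apply: le_trans (_ : _ <= inf [set root_sup t q | q in @normalized_poly R t]) _.
  by apply: ge_inf; [exists r => _ [s s0 <-]; exact: inner_ge|exists t].
apply: ge_inf; last by exists p.
by exists r => _ [q qn <-]; exact: normalized_poly_sup_ge.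
Qed.
End EllipseFactor.

(** * Jacobian and eigenvalues of the momentum map *)

Lemma differentiable_mulmxr (R : realType) m n (M : 'M[R]_(m, n)) (u : 'rV[R]_m) :
  differentiable (mulmxr M : 'rV[R]_m -> 'rV[R]_n) u.
Proof.
have -> : (mulmxr M : 'rV[R]_m -> 'rV[R]_n)
    = \sum_(i < m) (fun v : 'rV[R]_m => v 0 i *: row i M).
  by apply/funext => v; rewrite /= mulmx_sum_row fct_sumE.
apply: differentiable_sum => i; apply: differentiableZl.
exact: differentiable_coord.
Qed.

Lemma diff_mulmxr (R : realType) m n (M : 'M[R]_(m, n)) (u : 'rV[R]_m) :
  'd (mulmxr M : 'rV[R]_m -> 'rV[R]_n) u = mulmxr M :> ('rV[R]_m -> 'rV[R]_n).
Proof.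
apply: diff_lin => v; exact: differentiable_continuous (differentiable_mulmxr M v).
Qed.

Lemma jacobian_polyak (R : realType) d (al be : R) (F : 'rV[R]_d -> 'rV[R]_d) w :
  differentiable F w ->
  jacobian (polyak al be F) (row_mx w w)
    = block_mx ((1 + be)%:M - al *: jacobian F w) 1%:M (- be)%:M 0.
Proof.
move=> dF.
(* [N] is the linear part of the map; [M] places [- al *: F x] in the left half. *)
pose N : 'M[R]_(d + d) := block_mx (1 + be)%:M 1%:M (- be)%:M 0.
pose M : 'M[R]_(d, d + d) := row_mx (- al)%:M 0.
have polyakE : polyak al be F
    = (mulmxr N : 'rV[R]_(d + d) -> 'rV[R]_(d + d))
      + ((mulmxr M : 'rV[R]_d -> 'rV[R]_(d + d)) \o (F \o lsubmx)).
  apply/funext => u; rewrite /polyak /= -[u in RHS]hsubmxK /=.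
  rewrite !fctE /= row_mxKl mul_row_block mul_mx_row add_row_mx.
  rewrite !mul_mx_scalar !mulmx0 !addr0 scale1r; congr row_mx.
  rewrite scalerDl scale1r scalerBr !scaleNr -!addrA; congr (_ + _).
  by rewrite addrC -!addrA.
have dl : differentiable (lsubmx : 'rV[R]_(d + d) -> 'rV[R]_d) (row_mx w w).
  exact: differentiable_lsubmx.
have dF' : differentiable F (lsubmx (row_mx w w)) by rewrite row_mxKl.
have dFl : differentiable (F \o lsubmx) (row_mx w w) by exact: differentiable_comp.
have dN := differentiable_mulmxr N (row_mx w w).
have dM := differentiable_mulmxr M ((F \o lsubmx) (row_mx w w)).
have dG := differentiable_comp dFl dM.
have diffFl v : 'd (F \o lsubmx) (row_mx w w) v = lsubmx v *m jacobian F w.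
  apply: (etrans (congr1 (@^~ v) (diff_comp dl dF'))).
  rewrite /= row_mxKl mul_rV_lin1 diff_lin //.
  exact: continuous_lsubmx.
have diffN v : 'd (mulmxr N) (row_mx w w) v = v *m N.
  exact: (congr1 (@^~ v) (diff_mulmxr N _)).
have diffM v : 'd (mulmxr M \o (F \o lsubmx)) (row_mx w w) v
    = lsubmx v *m jacobian F w *m M.
  apply: (etrans (congr1 (@^~ v) (diff_comp dFl dM))).
  apply: (etrans (congr1 (@^~ _) (diff_mulmxr M _))).
  by rewrite /= diffFl.
apply/row_matrixP => i; rewrite !rowE; move: (delta_mx _ _) => v.
rewrite {1}/jacobian mul_rV_lin1 polyakE.
apply: (etrans (congr1 (@^~ v) (diffD dN dG))).
apply: (etrans (congr2 _ (diffN v) (diffM v))).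
rewrite -[v in LHS]hsubmxK -[v in RHS]hsubmxK row_mxKl.
rewrite /N /M mul_mx_row !mul_row_block add_row_mx !mulmx0 !addr0; congr row_mx.
by rewrite mulmxBr -scalemxAr addrAC !mul_mx_scalar scaleNr.
Qed.

(** A row eigenvector has the form [(z y, y)], and its right half [y] is an eigenvector of [A]. *)
Lemma eigenvalue_polyak (K : fieldType) d (A : 'M[K]_d) (al be z : K) :
  al != 0 -> z != 0 ->
  eigenvalue (block_mx ((1 + be)%:M - al *: A) 1%:M (- be)%:M 0) z ->
  eigenvalue A ((1 + be - z - be / z) / al).
Proof.
move=> al0 z0 /eigenvalueP[v vE v0]; rewrite -(hsubmxK v) in vE v0.
move: (lsubmx v) (rsubmx v) vE v0 => x y.
rewrite mul_row_block scale_row_mx => /eq_row_mx[].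
rewrite mulmx1 mulmx0 addr0 => /[swap] -> eqx.
move=> v0; have y0 : y != 0.
  by apply: contraNneq v0 => ->; rewrite scaler0 row_mx0.
apply/eigenvalueP; exists y => //.
apply: (scalerI (mulf_neq0 al0 z0)); rewrite scalerA.
have -> : al * z * ((1 + be - z - be / z) / al) = (1 + be) * z - be - z * z.
  by field; rewrite al0 z0.
move: eqx; rewrite mulmxBr !mul_mx_scalar -scalemxAr -scalemxAl scaleNr => eqx.
by rewrite !scalerBl -!scalerA -eqx opprB addrA subrK subKr.
Qed.

(** * Optimal parameters for the ellipse *)

(** This is [D], since [c^2 - a^2 = mu * L]; it is the larger root of [D^2 - 2 c D + a^2 - b^2]. *)
Definition ellipse_scale (R : realType) (mu L eps : R) : R :=
  (mu + L) / 2 + Num.sqrt (mu * L + eps ^+ 2).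

Definition polyak_step (R : realType) (mu L eps : R) : R :=
  2 / ellipse_scale mu L eps.

Definition polyak_momentum (R : realType) (mu L eps : R) : R :=
  (((L - mu) / 2) ^+ 2 - eps ^+ 2) / ellipse_scale mu L eps ^+ 2.

Definition polyak_rate (R : realType) (mu L eps : R) : R :=
  ((L - mu) / 2 + eps) / ellipse_scale mu L eps.

(** The quadratic equation for [D] is [al * c = 1 + k]; the bound [r < 1] holds because [a < c] and
    [b < s], where [D = c + s]. *)
Lemma joukowski_ellipse (R : realType) (mu L eps : R) :
  0 < mu -> mu < L -> 0 < eps ->
  joukowski ((mu + L) / 2) ((L - mu) / 2) eps (polyak_rate mu L eps)
    (polyak_momentum mu L eps) (polyak_step mu L eps).
Proof.
move=> mu0 muL eps0; rewrite /polyak_rate /polyak_momentum /polyak_step.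
set D := ellipse_scale mu L eps.
pose s : R := Num.sqrt (mu * L + eps ^+ 2).
have L0 : 0 < L := lt_trans mu0 muL.
have muLp : 0 < mu * L by rewrite mulr_gt0.
have ss : s ^+ 2 = mu * L + eps ^+ 2 by rewrite sqr_sqrtr // addr_ge0 ?sqr_ge0 ?ltW.
have s_eps : eps < s.
  by rewrite -(@ltr_pXn2r _ 2) ?nnegrE ?sqrtr_ge0 ?ltW // ss ltrDr.
have D0 : 0 < D by rewrite /D /ellipse_scale -/s; lra.
have a0 : 0 < (L - mu) / 2 by lra.
have E : eps ^+ 2 = s ^+ 2 - mu * L by rewrite ss addrC addKr.
split => //.
- by rewrite divr_gt0 //; lra.
- by rewrite ltr_pdivrMr // mul1r /D /ellipse_scale -/s; lra.
- by rewrite divr_gt0.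
- by rewrite E /D /ellipse_scale -/s; field; rewrite gt_eqF //; lra.
- by field; rewrite !gt_eqF //; lra.
- by field; rewrite !gt_eqF //; lra.
Qed.

Lemma asymptotic_convergence_factorE (R : realType) (mu L eps : R) :
  0 < mu -> mu < L -> 0 < eps ->
  asymptotic_convergence_factor (ellipse mu L eps) = polyak_rate mu L eps.
Proof.
move=> mu0 muL eps0.
exact: asymptotic_convergence_factor_ellipse (joukowski_ellipse mu0 muL eps0).
Qed.

Lemma spectral_radius_polyak_le (R : realType) (mu L eps : R) d
    (F : 'rV[R]_d -> 'rV[R]_d) w :
  0 < mu -> mu < L -> 0 < eps -> differentiable F w ->
  (forall z, eigenvalue (map_mx (real_complex R) (jacobian F w)) z ->
     ellipse mu L eps z) ->
  spectral_radius (jacobian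
      (polyak (polyak_step mu L eps) (polyak_momentum mu L eps) F) (row_mx w w))
    <= polyak_rate mu L eps.
Proof.
move=> mu0 muL eps0 dF JE; rewrite jacobian_polyak //.
have := joukowski_ellipse mu0 muL eps0.
set r := polyak_rate _ _ _; set k := polyak_momentum _ _ _.
set al := polyak_step _ _ _ => jk.
have [_ _ r0 _ al0 _ _ _] := jk.
have root_le : ubound [set modulus z | z in [set z : R[i] | eigenvalue
    (map_mx (real_complex R)
       (block_mx ((1 + k)%:M - al *: jacobian F w) 1%:M (- k)%:M 0)) z]] r.
  (* The eigenvalue 0 is set apart because the correspondence divides by [z]. *)
  move=> _ [z Jz <-]; have [->|z0] := eqVneq z 0.
    by rewrite (modulus_real 0) normr0 ltW.
  move: Jz; rewrite /= map_block_mx map_mxB map_mxZ !map_scalar_mx map_mx0.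
  rewrite rmorphN rmorphD rmorph1.
  have al0' : al%:C%C != 0 by rewrite (inj_eq (@complexI R) al 0) gt_eqF.
  move/(eigenvalue_polyak al0' z0)/JE => El.
  apply: (joukowski_root_le jk El); field.
  by rewrite z0 al0'.
rewrite /spectral_radius; set S := [set _ | _ in _] in root_le *.
have [S0|S0] := pselect (S !=set0); first exact: ge_sup.
(* Without eigenvalues, as in dimension 0, [sup] takes the value 0, which is below [r]. *)
have -> : S = set0 by apply/seteqP; split => // x Sx; case: S0; exists x.
by rewrite sup0 ltW.
Qed.

(** * Expansion of the rate *)

Definition scaled_rate (R : realType) (x e : R) : R :=
  (1 - x + 2 * e) / (1 + x + 2 * Num.sqrt (x + e ^+ 2)).

(** The rate is homogeneous of degree 0 in [mu], [L], [eps]; hence constants uniform in [mu] and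
    [L]. *)
Lemma polyak_rate_scaled (R : realType) (mu L e : R) : 0 < mu -> 0 < L -> 0 < e ->
  polyak_rate mu L (L * e) = scaled_rate (mu / L) e.
Proof.
move=> mu0 L0 e0; rewrite /polyak_rate /ellipse_scale /scaled_rate.
have -> : mu * L + (L * e) ^+ 2 = L ^+ 2 * (mu / L + e ^+ 2) by field; rewrite gt_eqF.
rewrite sqrtrM ?sqr_ge0 // sqrtr_sqr gtr0_norm //.
have := sqrtr_ge0 (mu / L + e ^+ 2); move: (Num.sqrt _) => s s0.
field; have := mulr_ge0 s0 (ltW L0) => h; rewrite !gt_eqF //; lra.
Qed.

(** The denominator is at least 1, so errors may be estimated after clearing it. *)
Lemma scaled_rate_dist (R : realType) (x e y N : R) : 0 < x -> 0 < e ->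
  `|1 - x + 2 * e - y * (1 + x + 2 * Num.sqrt (x + e ^+ 2))| <= N ->
  `|scaled_rate x e - y| <= N.
Proof.
move=> x0 e0; set D := 1 + x + _ => H.
have D1 : 1 <= D by rewrite /D; have := sqrtr_ge0 (x + e ^+ 2); lra.
have D0 : 0 < D by lra.
have -> : scaled_rate x e - y = (1 - x + 2 * e - y * D) / D.
  by rewrite /scaled_rate -/D; field; rewrite gt_eqF.
rewrite normrM normfV (gtr0_norm D0) ler_pdivrMr //; apply: (le_trans H).
by rewrite ler_peMr // (le_trans (normr_ge0 _) H).
Qed.

Section Expansions.
Variables (R : realType) (x e : R).

(** The root [s] lies between [q] and [q + e], so [e] enters only the error. *)
Lemma scaled_rate_small : 0 < x -> x < 1 -> 0 < e -> e <= 1 ->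
  `|scaled_rate x e - (1 - 2 * Num.sqrt x)| <= 8 * x + 8 * e.
Proof.
move=> x0 x1 e0 e1; apply: scaled_rate_dist => //.
set s := Num.sqrt (x + e ^+ 2); set q := Num.sqrt x.
have q0 : 0 <= q by exact: sqrtr_ge0.
have s0 : 0 <= s by exact: sqrtr_ge0.
have qq : q ^+ 2 = x by rewrite sqr_sqrtr // ltW.
have ss : s ^+ 2 = x + e ^+ 2 by rewrite sqr_sqrtr // addr_ge0 ?sqr_ge0 ?ltW.
clearbody s q; subst x.
have q1 : q <= 1 by nra.
have qs : q <= s by nra.
have sqe : s <= q + e by nra.
rewrite ler_norml; apply/andP; split; nra.
Qed.

Lemma scaled_rate_critical : 0 < x -> x < 1 ->
  `|scaled_rate x (Num.sqrt x) - (1 - 2 * (Num.sqrt 2 - 1) * Num.sqrt x)| <= 12 * x.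
Proof.
move=> x0 x1; apply: scaled_rate_dist; rewrite ?sqrtr_gt0 //.
rewrite sqr_sqrtr ?(ltW x0) //.
have -> : x + x = 2 * x by lra.
rewrite sqrtrM //.
set q := Num.sqrt x; set t := Num.sqrt 2.
have q0 : 0 <= q by exact: sqrtr_ge0.
have t0 : 0 <= t by exact: sqrtr_ge0.
have qq : q ^+ 2 = x by rewrite sqr_sqrtr // ltW.
have tt : t ^+ 2 = 2 by rewrite sqr_sqrtr.
clearbody q t; subst x.
have q1 : q <= 1 by nra.
have t1 : 1 <= t by nra.
have t2 : t <= 2 by nra.
(* The terms linear in [q] cancel, leaving [q ^+ 2] times a bounded factor. *)
have -> : 1 - q ^+ 2 + 2 * q - (1 - 2 * (t - 1) * q) * (1 + q ^+ 2 + 2 * (t * q))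
  = q ^+ 2 * (- 2 + 2 * (t - 1) * q + 4 * t ^+ 2 - 4 * t) by ring.
rewrite normrM tt (ger0_norm (sqr_ge0 q)) mulrC.
rewrite ler_wpM2r ?sqr_ge0 //.
rewrite ler_norml; apply/andP; split; nra.
Qed.

Lemma scaled_rate_large : 0 < x -> x <= e -> e <= 1 ->
  `|scaled_rate x e - (1 - x / e)| <= 5 * x + 2 * (x ^+ 2 / e ^+ 3).
Proof.
move=> x0 xe e1; have e0 : 0 < e := lt_le_trans x0 xe.
apply: scaled_rate_dist => //.
set s := Num.sqrt (x + e ^+ 2).
have s0 : 0 <= s by exact: sqrtr_ge0.
have ss : s ^+ 2 = x + e ^+ 2 by rewrite sqr_sqrtr // addr_ge0 ?sqr_ge0 ?ltW.
set f := x / e; have fe : x = f * e by rewrite divfK // gt_eqF.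
have f0 : 0 < f by rewrite divr_gt0.
have -> : x ^+ 2 / e ^+ 3 = f ^+ 2 / e by rewrite /f; field; rewrite gt_eqF.
have f1 : f <= 1 by rewrite /f ler_pdivrMr // mul1r.
clearbody s f; subst x.
have es : e <= s by nra.
have se : s <= e + f / 2 by nra.
(* [(s - e) ^+ 2 / e] is twice the amount by which [s] falls short of its first-order value
   [e + f / 2]. *)
have -> : 1 - f * e + 2 * e - (1 - f) * (1 + f * e + 2 * s)
  = - 2 * (f * e) + (s - e) ^+ 2 / e + f * (f * e) + 2 * f * s.
  have -> : (s - e) ^+ 2 / e = f + 2 * e - 2 * s.
    by rewrite sqrrB ss; field; rewrite gt_eqF.
  by ring.
have h : (s - e) ^+ 2 / e <= f ^+ 2 / e.
  rewrite ler_wpM2r ?invr_ge0 ?(ltW e0) // ler_pXn2r ?nnegrE //; lra.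
have h0 : 0 <= (s - e) ^+ 2 / e by rewrite divr_ge0 ?sqr_ge0 ?ltW.
have h2 : f ^+ 2 <= f ^+ 2 / e by rewrite ler_pdivlMr // ler_piMr ?sqr_ge0.
move: h h0 h2; move: (_ / e) (f ^+ 2 / e) => P Q *.
rewrite ler_norml; apply/andP; split; nra.
Qed.

End Expansions.

(** Reduces each case to one variable; [delta = 1] suffices as the bound covers all of
    [0 < x < 1]. *)
Lemma bigO_ratio_scaled (R : realType) (theta : R) (f g : R -> R) (C : R) :
  (forall x, 0 < x -> x < 1 -> `|scaled_rate x (x `^ theta) - f x| <= C * `|g x|) ->
  bigO_ratio (fun mu L => asymptotic_convergence_factor
                (ellipse mu L (L * (mu / L) `^ theta)) - f (mu / L)) g.
Proof.
move=> H; exists C, 1; split => // mu L mu0 muL x1.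
have L0 : 0 < L := lt_trans mu0 muL.
have x0 : 0 < mu / L by rewrite divr_gt0.
have e0 : 0 < (mu / L) `^ theta by rewrite powR_gt0.
rewrite asymptotic_convergence_factorE ?mulr_gt0 // polyak_rate_scaled //.
exact: H.
Qed.

Lemma powR_le_exponent (R : realType) (x p q : R) :
  0 < x -> x < 1 -> p <= q -> x `^ q <= x `^ p.
Proof. by move=> x0 x1 pq; rewrite ger_powR // x0 ltW. Qed.

Theorem proposition6 (R : realType) :
  (forall theta : R, 0 < theta ->
    let rho (mu L : R) :=
      asymptotic_convergence_factor (ellipse mu L (L * (mu / L) `^ theta)) in
    (2^-1 < theta ->
       bigO_ratio (fun mu L => rho mu L - (1 - 2 * Num.sqrt (mu / L)))
                  (fun x => x `^ (Num.min theta 1)))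
    /\ (theta = 2^-1 ->
       bigO_ratio (fun mu L => rho mu L
                     - (1 - 2 * (Num.sqrt 2 - 1) * Num.sqrt (mu / L)))
                  (fun x => x))
    /\ (theta < 2^-1 ->
       bigO_ratio (fun mu L => rho mu L - (1 - (mu / L) `^ (1 - theta)))
                  (fun x => x `^ (Num.min 1 (2 - 3 * theta)))))
  /\ (exists alpha beta : R -> R -> R -> R,
       forall mu L eps : R, 0 < mu -> mu < L -> 0 < eps ->
         0 < alpha mu L eps
         /\ (eps < (L - mu) / 2 -> 0 < beta mu L eps)
         /\ forall (d : nat) (F : 'rV[R]_d -> 'rV[R]_d) (omega : 'rV[R]_d),
              (forall x, differentiable F x) ->
              F omega = 0 ->
              (forall z : R[i],
                 eigenvalue (map_mx (real_complex R) (jacobian F omega)) z ->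
                 ellipse mu L eps z) ->
              spectral_radius
                (jacobian (polyak (alpha mu L eps) (beta mu L eps) F)
                          (row_mx omega omega))
              <= asymptotic_convergence_factor (ellipse mu L eps)).
Proof.
split.
  move=> theta theta0 rho; split; [|split] => Htheta.
  - apply: (@bigO_ratio_scaled _ theta (fun x => 1 - 2 * Num.sqrt x) _ 16) => x x0 x1.
    rewrite (ger0_norm (powR_ge0 _ _)).
    have e1 : x `^ theta <= 1 by rewrite -(powRr0 x) powR_le_exponent // ltW.
    apply: (le_trans (scaled_rate_small x0 x1 (powR_gt0 _ x0) e1)).
    have : x <= x `^ Num.min theta 1.
      by rewrite -{1}(powRr1 (ltW x0)) powR_le_exponent // ge_min lexx orbT.
    have : x `^ theta <= x `^ Num.min theta 1.
      by rewrite powR_le_exponent // ge_min lexx.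
    lra.
  - apply: (@bigO_ratio_scaled _ theta
              (fun x => 1 - 2 * (Num.sqrt 2 - 1) * Num.sqrt x) _ 12) => x x0 x1.
    by rewrite Htheta powR12_sqrt ?(ltW x0) // (gtr0_norm x0) scaled_rate_critical.
  - apply: (@bigO_ratio_scaled _ theta (fun x => 1 - x `^ (1 - theta)) _ 7) => x x0 x1.
    have x_neq0 : x != 0 by rewrite gt_eqF.
    rewrite (ger0_norm (powR_ge0 _ _)).
    have e1 : x `^ theta <= 1 by rewrite -(powRr0 x) powR_le_exponent // ltW.
    have xe : x <= x `^ theta.
      by rewrite -{1}(powRr1 (ltW x0)) powR_le_exponent //; lra.
    have -> : x `^ (1 - theta) = x / x `^ theta.
      by rewrite powRB ?x_neq0 ?implybT // powRr1 // ltW.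
    apply: (le_trans (scaled_rate_large x0 xe e1)).
    (* This remainder is the source of the exponent [2 - 3 * theta]. *)
    have -> : x ^+ 2 / (x `^ theta) ^+ 3 = x `^ (2 - 3 * theta).
      rewrite powRB ?x_neq0 ?implybT // (mulrC 3) powRrM !powR_mulrn ?powR_ge0 //.
      exact: ltW.
    have : x <= x `^ Num.min 1 (2 - 3 * theta).
      by rewrite -{1}(powRr1 (ltW x0)) powR_le_exponent // ge_min lexx.
    have : x `^ (2 - 3 * theta) <= x `^ Num.min 1 (2 - 3 * theta).
      by rewrite powR_le_exponent // ge_min lexx orbT.
    lra.
exists (@polyak_step R), (@polyak_momentum R) => mu L eps mu0 muL eps0.
have jk := joukowski_ellipse mu0 muL eps0.
split; first exact: jk_al jk.
split=> [eps_lt|d F omega dF _ JE].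
  (* Division by 0 gives 0, so a positive step excludes a zero scale. The momentum then has the sign
     of [a^2 - b^2]. *)
  have D0 : ellipse_scale mu L eps != 0.
    apply/eqP => D0; have := jk_al jk.
    by rewrite /polyak_step D0 invr0 mulr0 ltxx.
  rewrite divr_gt0 ?exprn_even_gt0 //.
  by rewrite subr_gt0 ltr_pXn2r ?nnegrE //; lra.
by rewrite asymptotic_convergence_factorE // spectral_radius_polyak_le.
Qed.
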